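(* Let $r$ be a prime power, $d$ a positive integer and $q=r^d$. For $i\in\mathbb{N}$ let $$C_i^{(2)}=\{(a,b)\in(\mathbb{F}_q^\times)^2:\ x^{r^2}+ax^r+bx \text{ has a maximal } i\text{-collision}\},\qquad c_i^{(2)}=\#C_i^{(2)}.$$ Then $C_i^{(2)}=\emptyset$ for $i\notin\{0,1,2,r+1\}$, and the following hold. (i) If $d$ is even, then $$[c_0^{(2)},c_1^{(2)},c_2^{(2)},c_{r+1}^{(2)}]=\left[\frac{r(q-1)^2}{2(r+1)},\ \frac{q(q-1)}{r},\ \frac{(q-1)^2(r-2)}{2(r-1)},\ \frac{(q-1)(q-r^2)}{r(r^2-1)}\right].$$ (ii) If $r$ is odd and $d$ is odd, then $$[c_0^{(2)},c_1^{(2)},c_2^{(2)},c_{r+1}^{(2)}]=\left[\frac{(qr-1)(q-1)}{2(r+1)},\ \frac{q(q-1)}{r},\ \frac{(q-1)(qr-2q-2r+3)}{2(r-1)},\ \frac{(q-r)(q-1)}{r(r^2-1)}\right].$$ (iii) If $r$ is even and $d$ is odd, then $$[c_0^{(2)},c_1^{(2)},c_2^{(2)},c_{r+1}^{(2)}]=\left[\frac{r(q^2-1)}{2(r+1)},\ \frac{(q-1)(q-r)}{r},\ \frac{(q-1)^2(r-2)}{2(r-1)},\ \frac{(q-r)(q-1)}{r(r^2-1)}\right].$$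
   Context: $\mathbb{F}_q[x;r]=\{\sum_{0\le i\le n}a_ix^{r^i}: n\ge 0,\ a_i\in\mathbb{F}_q\}$ is the ring (under addition and composition) of $r$-additive polynomials over $\mathbb{F}_q$. An $i$-collision is a set of $i$ distinct pairs $(g,h)$ of monic polynomials in $\mathbb{F}_q[x;r]$, here with $\deg g=\deg h=r$, all with the same composition $f=g\circ h$; it is maximal if it is not contained in an $(i+1)$-collision. So $x^{r^2}+ax^r+bx$ has a maximal $i$-collision iff it has exactly $i$ such decompositions; equivalently, $x^{r+1}+ax+b$ has exactly $i$ roots in $\mathbb{F}_q$. *)

(* Defs.v *)
From HB Require Import structures.
From mathcomp Require Import all_boot all_order all_algebra.
From mathcomp Require Import finmap boolp.

Set Implicit Arguments.
Unset Strict Implicit.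
Unset Printing Implicit Defensive.

Import GRing.Theory.
Local Open Scope ring_scope.
Local Open Scope fset_scope.

Section Collisions.

Variables (F : finFieldType) (r : nat).

Definition r_additive (f : {poly F}) : Prop :=
  exists (n : nat) (a : nat -> F), f = \sum_(i < n.+1) a i *: 'X^(r ^ i).

(* [size] is the degree plus one. *)
Definition collision_component (g : {poly F}) : Prop :=
  [/\ r_additive g, g \is monic & size g = r.+1].

(* The common composition [f] is a parameter, so that the empty collision of
   [f] (the case [i = 0]) is meaningful: it is maximal iff [f] has no
   decomposition at all. *)
Definition is_collision (f : {poly F}) (i : nat)
    (S : {fset {poly F} * {poly F}}) : Prop :=
  #|` S| = i /\
  forall gh, gh \in S ->
    [/\ collision_component gh.1, collision_component gh.2
      & f = gh.1 \Po gh.2].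

Definition is_maximal_collision (f : {poly F}) (i : nat)
    (S : {fset {poly F} * {poly F}}) : Prop :=
  is_collision f i S /\
  ~ exists T : {fset {poly F} * {poly F}}, is_collision f i.+1 T /\ S `<=` T.

Definition has_maximal_collision (f : {poly F}) (i : nat) : Prop :=
  exists S : {fset {poly F} * {poly F}}, is_maximal_collision f i S.

Definition C2 (i : nat) : {set F * F} :=
  [set ab | [&& ab.1 != 0, ab.2 != 0 &
     `[< has_maximal_collision
           ('X^(r ^ 2) + ab.1 *: 'X^r + ab.2 *: 'X) i >]]].

(* Rational-valued, so that the closed formulas use exact division. *)
Definition c2 (i : nat) : rat := #|C2 i|%:R.

End Collisions.

(* Main.v *)
(* Decompositions of [x^(r^2) + a x^r + b x] are the roots of the trinomial
   [v^(r+1) - a v + b] in [F_q].  Moving two roots to [0] and infinity turns the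
   remaining ones into the solutions of [w^(r-1) = v / v'], so the number [n] of
   roots is 0, 1, 2 or r + 1, and for n >= 2 it is r + 1 exactly when the ratio
   [v / v'] is an (r-1)-th power.  Double counting determines the four
   cardinalities: they are recovered from the sums over all [(a, b)] of 1, [n],
   [n (n - 1)] and [n (n - 1)] restricted to [n = r + 1], which reduce to
   counting roots of unity in [F_q]. *)

Require Import Defs.
From mathcomp Require Import all_boot all_order all_algebra.
From mathcomp Require Import cyclic finfield finmap boolp.
From mathcomp Require Import zify ring.

Set Implicit Arguments.
Unset Strict Implicit.
Unset Printing Implicit Defensive.

Import GRing.Theory Num.Theory.
Local Open Scope ring_scope.

(** * Roots of unity and power residues in a finite field *)

Lemma expf_gcd_eq1 (F : fieldType) (x : F) (m n : nat) : (0 < m)%N ->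
  (x ^+ gcdn m n == 1) = (x ^+ m == 1) && (x ^+ n == 1).
Proof.
move=> m_gt0; apply/idP/andP=> [/eqP xg1 | [/eqP xm1 xn1]].
  have xk1 k : (gcdn m n %| k)%N -> x ^+ k == 1.
    by case/dvdnP=> l ->; rewrite mulnC exprM xg1 expr1n.
  by rewrite !xk1 ?dvdn_gcdl ?dvdn_gcdr.
(* The order of [x] divides both [m] and [n], hence their gcd. *)
have [o o_prim o_m] := prim_order_exists m_gt0 xm1.
by rewrite -(prim_order_dvd o_prim) dvdn_gcd o_m (prim_order_dvd o_prim).
Qed.

Lemma expf_card_eq1 (F : finFieldType) (x : F) : x != 0 -> x ^+ #|F|.-1 = 1.
Proof.
move=> x0; apply: (mulIf x0); rewrite mul1r -exprSr prednK ?expf_card //.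
by rewrite (cardD1 x).
Qed.

(** The [q - 1] nonzero elements are distinct roots of [X^(q-1) - 1], which forces a primitive one
    among them. *)
Lemma prim_root_exists (F : finFieldType) :
  exists z : F, #|F|.-1.-primitive_root z.
Proof.
have q1 : (0 < #|F|.-1)%N by rewrite -subn1 subn_gt0 finNzRing_gt1.
have : has #|F|.-1.-primitive_root (enum [set~ (0 : F)]).
  apply: has_prim_root => //.
  - apply/allP=> x; rewrite mem_enum !inE => x0.
    by rewrite unity_rootE expf_card_eq1.
  - exact: enum_uniq.
  - by rewrite -cardE cardsC1.
by case/hasP=> z _ zP; exists z.
Qed.

(** Since every nonzero [x] satisfies [x^(q-1) = 1], the exponent [n] can be replaced by its gcd [g]
    with [q - 1]; the solutions are then the powers of a primitive [g]-th root of unity. *)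
Lemma card_unity_roots (F : finFieldType) (n : nat) : (0 < n)%N ->
  #|[set x : F | x ^+ n == 1]| = gcdn n #|F|.-1.
Proof.
move=> n_gt0; have [z z_prim] := prim_root_exists F.
set g := gcdn _ _; have g_gt0 : (0 < g)%N by rewrite gcdn_gt0 n_gt0.
have w_prim := dvdn_prim_root z_prim (dvdn_gcdr n _).
rewrite -/g in w_prim; set w := z ^+ _ in w_prim.
have -> : [set x : F | x ^+ n == 1] = [set w ^+ i | i : 'I_g].
  apply/setP=> x; rewrite inE.
  have -> : (x ^+ n == 1) = (x ^+ g == 1).
    rewrite expf_gcd_eq1 //; case: eqP => //= xn1.
    rewrite expf_card_eq1 ?eqxx //; apply: contra_eq_neq xn1 => ->.
    by rewrite expr0n gtn_eqF // eq_sym oner_neq0.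
  apply/eqP/imsetP => [xg1 | [i _ ->]].
    by have [i ->] := prim_rootP w_prim xg1; exists i.
  by rewrite exprAC (prim_expr_order w_prim) expr1n.
rewrite card_in_imset ?card_ord // => i j _ _ /eqP.
by rewrite (eq_prim_root_expr w_prim) !modn_small // => /eqP/val_inj.
Qed.

Lemma card_pred_dvd (r d : nat) : (r.-1 %| (r ^ d).-1)%N.
Proof. by rewrite predn_exp dvdn_mulr. Qed.

(* [F^*] is cyclic, so its [n]-th powers are the [(q - 1) / n]-torsion. *)
Lemma card_expf_eq (F : finFieldType) (n : nat) (c : F) :
  (0 < n)%N -> (n %| #|F|.-1)%N -> c != 0 ->
  #|[set x : F | x ^+ n == c]| = if c ^+ (#|F|.-1 %/ n) == 1 then n else 0%N.
Proof.
move=> n_gt0 n_dvd c0; case: eqP => [cm1 | cm1]; last first.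
  apply: eq_card0 => x; rewrite inE; apply/negP => /eqP xc; case: cm1.
  rewrite -xc -exprM mulnC divnK // expf_card_eq1 //.
  by apply: contraNneq c0 => x0; rewrite -xc x0 expr0n gtn_eqF.
have [z z_prim] := prim_root_exists F.
have [i c_zi] := prim_rootP z_prim (expf_card_eq1 c0).
have : (#|F|.-1 %| i * (#|F|.-1 %/ n))%N.
  by rewrite (prim_order_dvd z_prim) exprM -c_zi cm1.
have q1 : (0 < #|F|.-1)%N by rewrite -subn1 subn_gt0 finNzRing_gt1.
have m_gt0 : (0 < #|F|.-1 %/ n)%N by rewrite divn_gt0 // (dvdn_leq q1 n_dvd).
move=> q_dvd; have : (n %| i)%N.
  by rewrite -(dvdn_pmul2r m_gt0) mulnC divnK.
case/dvdnP=> k ik; set s := z ^+ k.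
have sn : s ^+ n = c by rewrite c_zi ik exprM.
have s0 : s != 0 by apply: contraNneq c0 => s0; rewrite -sn s0 expr0n gtn_eqF.
(* The [n]-th roots of [c] form the coset of [s] modulo the [n]-th roots of unity. *)
transitivity #|[set x : F | x ^+ n == 1]|; last first.
  by rewrite card_unity_roots //; apply/gcdn_idPl.
rewrite -[RHS](card_imset _ (mulfI s0)); apply: eq_card => x; rewrite !inE.
apply/eqP/imsetP => [xc | [y]]; last first.
  by rewrite inE => /eqP y1 ->; rewrite exprMn y1 mulr1.
by exists (x / s); [rewrite inE expr_div_n xc sn divff | rewrite mulrC divfK].
Qed.

(** * Roots of the trinomial when the [r]-th power map is additive *)

Section TrinomialRoots.

Variables (F : finFieldType) (r : nat).
Hypothesis r_gt1 : (1 < r)%N.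
Hypothesis exprDr : forall x y : F, (x + y) ^+ r = x ^+ r + y ^+ r.
Hypothesis r_dvd : (r.-1 %| #|F|.-1)%N.

(** The signs come from eliminating [u] from [a = u + v^r] and [b = u v]. *)
Definition trinomial_roots (ab : F * F) : {set F} :=
  [set v | v ^+ r.+1 - ab.1 * v + ab.2 == 0].

Lemma exprBr (x y : F) : (x - y) ^+ r = x ^+ r - y ^+ r.
Proof. by rewrite -[in RHS](subrK y x) [in RHS]exprDr addrK. Qed.

Lemma trinomial_root_neq0 ab v : ab.2 != 0 -> v \in trinomial_roots ab -> v != 0.
Proof.
move=> b0; rewrite inE; apply: contraTneq => ->.
by rewrite expr0n mulr0 subrr add0r.
Qed.

(** Besides [w = 0], the solutions are the [(r-1)]-th roots of [v / v']: there are [r - 1] or none,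
    according to the power residue test. *)
Lemma card_twisted_line (v v' : F) : v != 0 -> v' != 0 ->
  #|[set w | v' * w ^+ r == v * w]| =
  if (v / v') ^+ (#|F|.-1 %/ r.-1) == 1 then r else 1%N.
Proof.
move=> v0 v'0; have r1_gt0 : (0 < r.-1)%N by case: r r_gt1 => [|[]].
have c0 : v / v' != 0 by rewrite mulf_neq0 ?invr_eq0.
have r_pos : (0 < r)%N by apply: ltnW.
rewrite (cardsD1 0) inE expr0n gtn_eqF // !mulr0 eqxx add1n.
have -> : [set w | v' * w ^+ r == v * w] :\ 0 = [set w | w ^+ r.-1 == v / v'].
  apply/setP=> w; rewrite !inE -{1}(prednK r_pos) exprSr.
  case: eqVneq => [-> | w0] /=.
    by rewrite expr0n gtn_eqF // eq_sym (negPf c0).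
  rewrite mulrA (inj_eq (mulIf w0)) -[RHS](inj_eq (mulfI v'0)).
  by rewrite [v' * (v / v')]mulrC divfK.
by rewrite card_expf_eq //; case: ifP; rewrite ?prednK.
Qed.

(* The Moebius map [w |-> (v w + v') / (1 + w)] sends [v'] to [0] and [v] to
   infinity; in the coordinate [w] the other roots are those of the
   [F_r]-linear equation [v' w^r = v w]. *)
Lemma moebius_trinomial a b v v' w : v \in trinomial_roots (a, b) ->
    v' \in trinomial_roots (a, b) -> 1 + w != 0 ->
  ((v * w + v') / (1 + w) \in trinomial_roots (a, b)) =
  ((v' - v) ^+ r * (v * w - v' * w ^+ r) == 0).
Proof.
rewrite !inE /= => /eqP + /eqP + w1.
have w1r : 1 + w ^+ r != 0 by rewrite -[1](expr1n _ r) -exprDr expf_neq0.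
rewrite exprBr !exprSr expr_div_n !exprDr !exprMn expr1n.
(* Once the [r]-th powers are independent variables, what remains is a rational identity modulo the
   two root equations, which [bE] and [av] solve for [b] and [a * (v' - v)]. *)
move: (v ^+ r) (v' ^+ r) (w ^+ r) w1r => V V' W w1r vE v'E.
have bE : b = a * v - V * v by rewrite -[LHS]subr0 -vE; ring.
have av : a * (v' - v) = V' * v' - V * v.
  by rewrite -[LHS]addr0 -v'E bE; ring.
rewrite -[LHS](inj_eq (mulIf w1)) -[LHS](inj_eq (mulIf w1r)) !mul0r.
congr (_ == 0).
transitivity ((V * W + V') * (v * w + v') - a * (v * w + v') * (1 + W)
              + b * (1 + w) * (1 + W)).
  by field; apply/andP.
have -> : (V * W + V') * (v * w + v') - a * (v * w + v') * (1 + W)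
   + b * (1 + w) * (1 + W)
  = (V' - V) * (v * w - v' * W) + (V' * v' - V * v - a * (v' - v)) * (1 + W).
  rewrite bE; ring.
by rewrite av subrr mul0r addr0.
Qed.

(** The Moebius map is a bijection from the solutions of [v' w^r = v w] onto the roots other than
    [v]; the root [v] itself is the value at infinity and accounts for the extra 1. *)
Lemma card_trinomial_roots ab v v' : ab.2 != 0 -> v \in trinomial_roots ab ->
    v' \in trinomial_roots ab -> v != v' ->
  #|trinomial_roots ab| =
  if (v / v') ^+ (#|F|.-1 %/ r.-1) == 1 then r.+1 else 2.
Proof.
case: ab => a b b0 vR v'R vv'.
have v0 := trinomial_root_neq0 b0 vR; have v'0 := trinomial_root_neq0 b0 v'R.
have vB : v' - v != 0 by rewrite subr_eq0 eq_sym.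
have vBr : (v' - v) ^+ r != 0 by rewrite expf_neq0.
pose L := [set w | v' * w ^+ r == v * w].
pose phi w := (v * w + v') / (1 + w).
(* At [w = -1] the equation of [L] would read [v' = v]. Writing [-1] as [0 - 1] gives [(-1)^r = -1]
   by additivity, whatever the parity of [r]. *)
have L1 w : w \in L -> 1 + w != 0.
  rewrite inE; apply: contraTneq => w1.
  have -> : w = 0 - 1 by rewrite -w1; ring.
  by rewrite exprBr expr1n expr0n gtn_eqF 1?ltnW // sub0r !mulrN1 eqr_opp eq_sym.
have -> : trinomial_roots (a, b) = v |: [set phi w | w in L].
  apply/setP=> x; rewrite in_setU1; case: eqVneq => [-> // | xv] /=.
  have xv0 : x - v != 0 by rewrite subr_eq0.
  apply/idP/imsetP => [xR | [w wL ->]].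
    (* This is the solution of [x = phi w]. *)
    pose w := (v' - x) / (x - v).
    have w1E : 1 + w = (v' - v) / (x - v) by rewrite /w; field.
    have w1 : 1 + w != 0 by rewrite w1E mulf_neq0 ?invr_eq0.
    have xE : x = phi w.
      by rewrite /phi w1E /w; field; apply/andP.
    exists w => //; move: xR; rewrite {1}xE moebius_trinomial // mulf_eq0.
    by rewrite (negPf vBr) /= subr_eq0 eq_sym inE.
  rewrite moebius_trinomial ?L1 // mulf_eq0 subr_eq0 [v * w == _]eq_sym.
  by move: wL; rewrite inE => ->; rewrite orbT.
rewrite cardsU1.
have -> : v \in [set phi w | w in L] = false.
  apply/imsetP=> -[w /L1 w1 vE]; case/eqP: vv'.
  have : v * (1 + w) = v * w + v' by rewrite {1}vE divfK.
  by rewrite mulrDr mulr1 addrC => /addrI.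
rewrite card_in_imset; first by rewrite card_twisted_line //; case: ifP.
move=> w1 w2 /L1 w1n /L1 w2n.
have phiE w : 1 + w != 0 -> phi w = v + (v' - v) / (1 + w).
  by move=> w0; rewrite /phi; field.
by rewrite !phiE // => /addrI/(mulfI vB)/invr_inj/addrI.
Qed.

Lemma card_trinomial_roots_in ab : ab.2 != 0 ->
  #|trinomial_roots ab| \in [:: 0; 1; 2; r.+1]%N.
Proof.
move=> b0; have [R1|/card_gt1P[v [v' [vR v'R vv']]]] := leqP #|trinomial_roots ab| 1.
  by case: #|_| R1 => [|[]].
by rewrite (card_trinomial_roots b0 vR v'R vv'); case: ifP; rewrite !inE eqxx ?orbT.
Qed.

(** * Double counting of trinomials with marked roots *)

Definition nonzero_pairs : {set F * F} := [set ab | (ab.1 != 0) && (ab.2 != 0)].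

Lemma trinomial_rootsE a b v :
  (v \in trinomial_roots (a, b)) = (b == a * v - v ^+ r.+1).
Proof.
rewrite inE /= -[RHS]subr_eq0; congr (_ == 0); ring.
Qed.

(** A root [v] determines [b = v (a - v^r)] from [a], so the nonvanishing conditions exclude exactly
    the two values [0] and [v^r] of [a]. *)
Lemma card_trinomials_1root v : v != 0 ->
  #|[set ab in nonzero_pairs | v \in trinomial_roots ab]| = #|F|.-2.
Proof.
move=> v0; have vr0 : v ^+ r != 0 by rewrite expf_neq0.
transitivity #|[set~ (0 : F)] :\ v ^+ r|; last first.
  by move: (cardsD1 (v ^+ r) [set~ (0 : F)]); rewrite !inE vr0 cardsC1 => ->.
pose f a := (a, a * v - v ^+ r.+1).
rewrite -[RHS](@card_imset _ _ f) => [|a a' [->] //].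
apply: eq_card => -[a b]; rewrite in_set trinomial_rootsE in_set /=.
have -> : (a, b) \in [set f a | a in [set~ 0] :\ v ^+ r] =
   [&& a != v ^+ r, a != 0 & b == a * v - v ^+ r.+1].
  apply/imsetP/and3P => [[a' +] [-> ->] | [avr a0 /eqP ->]].
    by rewrite !inE => /andP[].
  by exists a; rewrite // !inE avr.
rewrite andbC andbCA [RHS]andbCA; congr (_ && _).
rewrite [RHS]andbC; apply: andb_id2l => /eqP ->.
by rewrite exprSr -mulrBl mulf_eq0 (negPf v0) orbF subr_eq0.
Qed.

(** Subtracting the two root equations determines [a], and then [b]. This [a] vanishes iff the
    [(r+1)]-th powers agree; for nonzero roots [b = 0] would give [v^r = a = v'^r], hence
    [(v - v')^r = 0]. *)
Lemma card_trinomials_2roots v v' : v != v' ->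
  #|[set ab in nonzero_pairs | (v \in trinomial_roots ab)
                               && (v' \in trinomial_roots ab)]|
  = [&& v != 0, v' != 0 & v ^+ r.+1 != v' ^+ r.+1].
Proof.
move=> vv'; have vB : v - v' != 0 by rewrite subr_eq0.
case: and3P => [[v0 v'0 vr] | nvr] /=; last first.
  apply: eq_card0 => -[a b]; rewrite inE; apply/negP => /and3P[ab vR v'R].
  case: nvr; move: ab; rewrite inE /= => /andP[a0 b0].
  split; [exact: trinomial_root_neq0 vR | exact: trinomial_root_neq0 v'R |].
  move: vR v'R; rewrite !trinomial_rootsE => /eqP -> /eqP vE.
  apply: contra_neq a0 => vr; apply: (mulIf vB); rewrite mul0r mulrBr.
  by rewrite -(subrr (v ^+ r.+1)) {2}vr -(subrK (v ^+ r.+1) (a * v)) vE; ring.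
pose a := (v ^+ r.+1 - v' ^+ r.+1) / (v - v').
have aE : a * (v - v') = v ^+ r.+1 - v' ^+ r.+1 by rewrite divfK.
rewrite -(cards1 (a, a * v - v ^+ r.+1)); apply: eq_card => -[x y].
rewrite in_set1 in_set trinomial_rootsE trinomial_rootsE in_set /=.
apply/and3P/eqP => [[_ /eqP yE /eqP yE'] | [-> ->]].
  suff xa : x = a by rewrite yE xa.
  apply: (mulIf vB); rewrite aE mulrBr -(subrK (v ^+ r.+1) (x * v)) -yE yE'.
  ring.
have bE : a * v - v ^+ r.+1 = a * v' - v' ^+ r.+1.
  apply/eqP; rewrite -subr_eq0 -(subrr (a * (v - v'))) {2}aE; apply/eqP; ring.
split; rewrite ?eqxx ?bE // mulf_neq0 ?invr_eq0 ?subr_eq0 //=.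
apply: contra_neq vv' => b0; apply/eqP; rewrite -subr_eq0.
have av' : v' ^+ r = a by apply: (mulIf v'0); rewrite -exprSr.
have av : v ^+ r = a.
  by apply: (mulIf v0); rewrite -exprSr; apply/esym/eqP; rewrite -subr_eq0 bE b0 subrr.
by move/eqP: (exprBr v v'); rewrite av av' subrr expf_eq0 => /andP[].
Qed.

Lemma sum_card_incidence (T : finType) (A : {set F * F}) (P : F * F -> T -> bool) :
  (\sum_(ab in A) #|[set x | P ab x]| = \sum_x #|[set ab in A | P ab x]|)%N.
Proof.
under eq_bigr do rewrite -sum1dep_card.
rewrite (exchange_big_dep predT) //=; apply: eq_bigr => x _.
by rewrite -sum1dep_card.
Qed.

Lemma sum_card_trinomial_roots :
  (\sum_(ab in nonzero_pairs) #|trinomial_roots ab| = #|F|.-1 * #|F|.-2)%N.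
Proof.
transitivity (\sum_(ab in nonzero_pairs) #|[set v | v \in trinomial_roots ab]|)%N.
  by apply: eq_bigr => ab _; rewrite cardsE.
(* The value [v = 0] contributes nothing, because it is a root only when [b = 0]. *)
rewrite sum_card_incidence (bigD1 0) //= eq_card0 => [|ab].
  rewrite add0n -(cardsC1 (0 : F)) -sum_nat_const; apply: eq_big => [v|v v0].
    by rewrite !inE.
  by rewrite card_trinomials_1root // cardsC1.
rewrite inE; apply/negP => /andP[]; rewrite inE => /andP[_ b0] vR.
by move/eqP: (trinomial_root_neq0 b0 vR).
Qed.

Lemma card_offdiag (T : finType) (B : {set T}) :
  #|[set xy in setX B B | xy.1 != xy.2]| = (#|B| * #|B|.-1)%N.
Proof.
have -> : [set xy in setX B B | xy.1 != xy.2] = setX B B :\: [set (x, x) | x in B].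
  apply/setP=> -[x y]; rewrite !inE /= andbC; apply: andb_id2r => /andP[xB _].
  by congr (~~ _); apply/eqP/imsetP => [<- | [z _ [-> ->]] //]; exists x.
rewrite cardsD cardsX (setIidPr _) ?card_imset => [|x y [] //|].
  by rewrite -subn1 mulnBr muln1.
by apply/subsetP => _ /imsetP[x xB ->]; rewrite inE xB.
Qed.

(** The predicate on the ratio allows two counts at once: [predT] gives [n (n - 1)], and the test
    for [(r-1)]-th powers keeps only the trinomials with [r + 1] roots. *)
Definition root_pairs (P : pred F) ab :=
  [set vv in setX (trinomial_roots ab) (trinomial_roots ab)
  | (vv.1 != vv.2) && P (vv.1 / vv.2)].

Definition root_ratios (P : pred F) : {set F} :=
  [set t | [&& t != 0, t ^+ r.+1 != 1 & P t]].

(* The trinomial is determined by two of its roots, and scaling acts freely on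
   pairs of roots, so only their ratio has to be counted. *)
Lemma sum_card_root_pairs (P : pred F) :
  (\sum_(ab in nonzero_pairs) #|root_pairs P ab| =
   #|F|.-1 * #|root_ratios P|)%N.
Proof.
rewrite sum_card_incidence -(cardsC1 (0 : F)) -cardsX.
set D := setX _ _.
(* [f] rebuilds an ordered pair of roots from its second member and the ratio. *)
pose f (x : F * F) := (x.2 * x.1, x.1).
have f_inj : {in D &, injective f}.
  move=> [v t] [v' t'] + _; rewrite !inE /= => /andP[v0 _] [+ vv'].
  by rewrite -{}vv' => /(mulIf v0) ->.
rewrite -(card_in_imset f_inj) -sum1_card [RHS]big_mkcond.
apply: eq_bigr => -[v v'] _ /=.
case: (boolP ((v != v') && P (v / v'))) => [/andP[vv' Pv] | nP]; last first.
  rewrite eq_card0 => [|ab]; last by rewrite in_set !andbF.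
  case: ifP => // /imsetP[[x t]]; rewrite !inE /= => /and4P[x0 t0 tr Pt] [vE v'E].
  case/negP: nP; rewrite vE v'E mulfK // Pt andbT.
  apply: contraNneq tr => /(canRL (mulfK x0)).
  by rewrite divff // => ->; rewrite expr1n.
transitivity #|[set ab in nonzero_pairs | (v \in trinomial_roots ab)
                               && (v' \in trinomial_roots ab)]|.
  by apply: eq_card => ab; rewrite !inE !andbT.
rewrite card_trinomials_2roots //.
have -> : (v, v') \in [set f x | x in D] = [&& v != 0, v' != 0 & v ^+ r.+1 != v' ^+ r.+1].
  apply/imsetP/and3P => [[[x t]] | [v0 v'0 vr]].
    rewrite !inE /= => /and4P[x0 t0 tr _] [-> ->].
    split; rewrite ?mulf_neq0 // exprMn; apply: contraNneq tr => tr.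
    by apply/eqP/(mulIf (expf_neq0 r.+1 x0)); rewrite mul1r.
  exists (v', v / v'); last by rewrite /f /= divfK.
  rewrite !inE /= v'0 Pv mulf_neq0 ?invr_eq0 //= andbT expr_div_n.
  apply: contra_neq vr => vr1.
  by rewrite -[RHS]mul1r -vr1 divfK ?expf_neq0.
by case: ifP.
Qed.

Lemma card_root_pairs_predT ab :
  #|root_pairs predT ab| = (#|trinomial_roots ab| * #|trinomial_roots ab|.-1)%N.
Proof. by rewrite -card_offdiag; apply: eq_card => vv; rewrite !inE andbT. Qed.

(** A single pair of distinct roots decides whether there are 2 or [r + 1] roots, and [r + 1]
    differs from 2. So either all ordered pairs pass the test or none does. *)
Lemma card_root_pairs_power ab : ab.2 != 0 ->
  #|root_pairs [pred t | t ^+ (#|F|.-1 %/ r.-1) == 1] ab| =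
  if #|trinomial_roots ab| == r.+1 then (r.+1 * r)%N else 0%N.
Proof.
move=> b0; case: eqP => n_eq.
  rewrite -[(r.+1 * r)%N]/(r.+1 * r.+1.-1)%N -n_eq -card_offdiag.
  apply: eq_card => -[v v']; rewrite !inE /=; apply: andb_id2l => /andP[vR v'R].
  apply: andb_idr => vv'; move: n_eq; rewrite (card_trinomial_roots b0 _ _ vv') ?inE //.
  by case: ifP => // _ [r1]; move: r_gt1; rewrite -r1.
apply: eq_card0 => -[v v']; rewrite in_set in_setX /=.
apply/negP => /and3P[/andP[vR v'R] vv' Pv].
by case: n_eq; rewrite (card_trinomial_roots b0 vR v'R vv') Pv.
Qed.

Lemma card_torsion_ratios :
  #|root_ratios predT| =
  (#|F|.-1 - gcdn r.+1 #|F|.-1)%N.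
Proof.
rewrite -card_unity_roots // -(cardsC1 (0 : F)).
rewrite -[in RHS](setIidPr _ : [set~ (0 : F)] :&: [set x | x ^+ r.+1 == 1] = _).
  by rewrite -cardsD; apply: eq_card => t; rewrite !inE andbT andbC.
apply/subsetP => x; rewrite !inE; apply: contraTneq => ->.
by rewrite expr0n eq_sym oner_eq0.
Qed.

(** As [m] divides [q - 1], there are exactly [m] elements with [t^m = 1]; those to be removed, with
    also [t^(r+1) = 1], are the roots of unity of order dividing the gcd. *)
Lemma card_power_ratios (m := (#|F|.-1 %/ r.-1)%N) :
  #|root_ratios [pred t | t ^+ m == 1]| =
  (m - gcdn m r.+1)%N.
Proof.
have q1 : (0 < #|F|.-1)%N by rewrite -subn1 subn_gt0 finNzRing_gt1.
have r1 : (0 < r.-1)%N by case: r r_gt1 => [|[]].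
have m_gt0 : (0 < m)%N by rewrite divn_gt0 // (dvdn_leq q1 r_dvd).
have m_dvd : (m %| #|F|.-1)%N by apply/dvdnP; exists r.-1; rewrite mulnC divnK.
have card_dvd k : (k %| m)%N -> #|[set t : F | t ^+ k == 1]| = k.
  move=> km; rewrite card_unity_roots ?(dvdn_gt0 m_gt0) //.
  exact/gcdn_idPl/(dvdn_trans km).
rewrite -[X in (X - _)%N](card_dvd m) // -[gcdn _ _](card_dvd _ (dvdn_gcdl m r.+1)).
rewrite -[in RHS](setIidPr _ : [set t | t ^+ m == 1]
                               :&: [set t | t ^+ gcdn m r.+1 == 1] = _).
  rewrite -cardsD; apply: eq_card => t; rewrite !inE expf_gcd_eq1 //.
  case: (t ^+ m =P 1) => [tm1|]; rewrite ?andbF //= !andbT.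
  case: eqVneq => // t0; move: tm1; rewrite t0 expr0n gtn_eqF // => /eqP.
  by rewrite eq_sym oner_eq0.
by apply/subsetP => t; rewrite !inE expf_gcd_eq1 // => /andP[].
Qed.

End TrinomialRoots.

(** * Decompositions of additive trinomials as roots *)

Section Decompositions.

Variables (F : finFieldType) (p e r : nat).
Hypotheses (p_char : p \in [pchar F]) (r_def : r = (p ^ e)%N) (r_gt1 : (1 < r)%N).

(** The ring is left general because additivity serves both in [F] and in its polynomial ring. *)
Lemma exprDr_pchar (R : comNzRingType) (x y : R) :
  p \in [pchar R] -> (x + y) ^+ r = x ^+ r + y ^+ r.
Proof.
move=> pR; apply: exprDn_pchar.
by rewrite r_def pnatX pnatE ?(pcharf_prime pR) // pR.
Qed.

Definition additive_binomial (u : F) : {poly F} := 'X^r + u *: 'X.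

Lemma coef_additive_binomial u i :
  (additive_binomial u)`_i = (i == r)%:R + u * (i == 1%N)%:R.
Proof. by rewrite coefD coefXn coefZ coefX. Qed.

Lemma additive_binomial_inj : injective additive_binomial.
Proof.
move=> u v /(congr1 (fun g : {poly F} => g`_1)).
by rewrite !coef_additive_binomial !mulr1 => /addrI.
Qed.

(** In degree [r] only the exponents [r^0 = 1] and [r^1 = r] can occur, and the coefficient of [X^r]
    is 1, so only the linear coefficient is free. *)
Lemma collision_componentE (g : {poly F}) :
  collision_component r g <-> exists u, g = additive_binomial u.
Proof.
split=> [[[n [a gE]] g_monic g_size] | [u ->]].
  exists g`_1; apply/polyP => i; rewrite coef_additive_binomial.
  have gr : g`_r = 1 by move/monicP: g_monic; rewrite lead_coefE g_size.
  have [-> | ir] := eqVneq i r; first by rewrite gr gtn_eqF // mulr0 addr0.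
  rewrite add0r; have [-> | i1] := eqVneq i 1%N; first by rewrite mulr1.
  rewrite mulr0; have [r_lt | i_le] := ltnP r i.
    by rewrite nth_default // g_size.
  rewrite gE coef_sum big1 // => j _; rewrite coefZ coefXn.
  case: eqP => [i_eq|]; last by rewrite mulr0.
  case: (nat_of_ord j) i_eq => [|[|k]] i_eq.
  - by rewrite i_eq expn0 in i1.
  - by rewrite i_eq expn1 eqxx in ir.
  - move: i_le; rewrite i_eq leqNgt -{1}(expn1 r) ltn_exp2l //.
have size_u : (size (u *: 'X : {poly F}) < size ('X^r : {poly F}))%N.
  by rewrite size_polyXn (leq_ltn_trans (size_scale_leq _ _)) // size_polyX ltnS.
split.
- exists 1%N, (fun i => if i == 0%N then u else 1).
  by rewrite !big_ord_recr big_ord0 /= add0r expn0 expn1 expr1 scale1r addrC.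
- by rewrite monicE lead_coefDl // lead_coefXn.
- by rewrite size_polyDl // size_polyXn.
Qed.

Lemma comp_additive_binomial u v :
  additive_binomial u \Po additive_binomial v =
  'X^(r ^ 2) + (u + v ^+ r) *: 'X^r + (u * v) *: 'X.
Proof.
have p_poly : p \in [pchar {poly F}] by rewrite pchar_poly.
rewrite comp_polyD comp_Xn_poly comp_polyZ comp_polyX /additive_binomial.
rewrite exprDr_pchar // exprZn -exprM mulnn scalerDr scalerA scalerDl.
by rewrite -!addrA; congr (_ + _); rewrite addrCA.
Qed.

Definition additive_trinomial (ab : F * F) : {poly F} :=
  'X^(r ^ 2) + ab.1 *: 'X^r + ab.2 *: 'X.

Lemma coef_additive_trinomial ab :
  ((additive_trinomial ab)`_r = ab.1) * ((additive_trinomial ab)`_1 = ab.2).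
Proof.
have r_r2 : (r == r ^ 2)%N = false by rewrite -{1}(expn1 r) eqn_exp2l.
have one_r2 : (1 == r ^ 2)%N = false.
  by rewrite -(expn0 r) eqn_exp2l.
have one_r : (1 == r)%N = false by rewrite ltn_eqF.
by rewrite !coefD !coefZ !coefXn !coefX r_r2 one_r2 eqxx one_r eq_sym one_r
  !mulr1 !mulr0 !addr0 !add0r.
Qed.

Lemma comp_eq_additive_trinomial ab u v :
  additive_trinomial ab = additive_binomial u \Po additive_binomial v <->
  ab.1 = u + v ^+ r /\ ab.2 = u * v.
Proof.
rewrite comp_additive_binomial; split=> [abE | [<- <-] //].
split.
  by rewrite -(coef_additive_trinomial ab).1 abE (coef_additive_trinomial (_, _)).
by rewrite -(coef_additive_trinomial ab).2 abE (coef_additive_trinomial (_, _)).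
Qed.

(** Collisions of [f] are the finite subsets of the set [D] of all its decompositions. One that
    misses an element of [D] can be enlarged by it, so [D] is the only maximal one. *)
Lemma has_maximal_collisionE (f : {poly F}) (D : {fset {poly F} * {poly F}}) i :
  (forall gh, gh \in D <->
     [/\ collision_component r gh.1, collision_component r gh.2
       & f = gh.1 \Po gh.2]) ->
  has_maximal_collision r f i <-> #|` D| = i.
Proof.
move=> DP; split=> [[S [[S_card SP] S_max]] | D_card].
  have S_sub : (S `<=` D)%fset by apply/fsubsetP => gh /SP/DP.
  suff D_sub : (D `<=` S)%fset.
    by rewrite -S_card; have -> : D = S by apply/eqP; rewrite eqEfsubset D_sub.
  apply/fsubsetP => gh ghD; apply: contra_notT S_max => ghS.
  exists (gh |` S)%fset; split; last exact: fsubsetU1.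
  split; first by rewrite cardfsU1 ghS S_card.
  by move=> gh'; rewrite in_fset1U => /orP[/eqP -> | /SP //]; apply/DP.
exists D; split; first by split=> // gh /DP.
move=> [T [[T_card TP] _]].
have : (T `<=` D)%fset by apply/fsubsetP => gh /TP/DP.
by move/fsubset_leq_card; rewrite T_card D_card ltnn.
Qed.

Lemma maximal_collision_card ab i : ab.2 != 0 ->
  has_maximal_collision r (additive_trinomial ab) i <->
  #|trinomial_roots r ab| = i.
Proof.
(* The left component is forced by [b = u v], where [b != 0] makes [v] invertible. *)
move=> b0; pose dec v := (additive_binomial (ab.2 / v), additive_binomial v).
have dec_inj : injective dec by move=> v w [_ /additive_binomial_inj].
rewrite (@has_maximal_collisionE _ [fset dec v | v in trinomial_roots r ab]%fset).
  by rewrite card_imfset //= -cardE.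
case=> g h /=; split.
  case/imfsetP => v /= vR [-> ->]; have v0 := trinomial_root_neq0 b0 vR.
  split; [by apply/collision_componentE; eexists.. |].
  apply/comp_eq_additive_trinomial; split; last by rewrite divfK.
  apply: (mulIf v0); rewrite mulrDl divfK // -exprSr.
  by case: (ab) vR => a b; rewrite trinomial_rootsE => /eqP -> /=; rewrite subrK.
case=> /collision_componentE[u ->] /collision_componentE[v ->].
case/comp_eq_additive_trinomial => aE bE.
have v0 : v != 0 by apply: contraNneq b0 => v0; rewrite bE v0 mulr0.
apply/imfsetP; exists v => /=; last by rewrite /dec bE mulfK.
by rewrite inE aE bE exprSr; apply/eqP; ring.
Qed.

Lemma C2E i :
  C2 F r i = [set ab in nonzero_pairs F | #|trinomial_roots r ab| == i].
Proof.
apply/setP => ab; rewrite !inE -andbA.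
apply: andb_id2l => _; apply: andb_id2l => b0.
by apply/asboolP/eqP => /maximal_collision_card; apply.
Qed.

End Decompositions.

(** * The linear system for the four cardinalities *)

Section RootCounts.

Variables (F : finFieldType) (r : nat).
Hypothesis r_gt1 : (1 < r)%N.
Hypothesis exprDr : forall x y : F, (x + y) ^+ r = x ^+ r + y ^+ r.
Hypothesis r_dvd : (r.-1 %| #|F|.-1)%N.

Definition trinomials_with_roots i : {set F * F} :=
  [set ab in nonzero_pairs F | #|trinomial_roots r ab| == i].

Local Notation c i := #|trinomials_with_roots i|.

Lemma sum_by_root_count (f : nat -> nat) :
  (\sum_(ab in nonzero_pairs F) f #|trinomial_roots r ab| =
   f 0 * c 0 + f 1 * c 1 + f 2 * c 2 + f r.+1 * c r.+1)%N.
Proof.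
have cE i : (f i * c i = \sum_(ab in nonzero_pairs F)
    f #|trinomial_roots r ab| * (#|trinomial_roots r ab| == i))%N.
  rewrite -sum1dep_card big_mkcondr big_distrr /=; apply: eq_bigr => ab _.
  by case: eqP => [-> | _]; rewrite ?muln0.
rewrite !cE -!big_split /=; apply: eq_bigr => ab; rewrite inE => /andP[_ b0].
rewrite -!mulnDr; have := card_trinomial_roots_in r_gt1 exprDr r_dvd b0.
(* With [r] neither 0 nor 1, the values 0, 1, 2 and [r + 1] are distinct and no trinomial is counted
   twice. *)
have r_neq0 : (r == 0%N) = false by rewrite gtn_eqF // ltnW.
have r_neq1 : (r == 1%N) = false by rewrite gtn_eqF.
by rewrite !inE => /or4P[] /eqP ->;
  rewrite /= ?eqSS ?eqxx ?[_ == r]eq_sym ?r_neq0 ?r_neq1 /= ?addn0 ?muln1.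
Qed.

Lemma root_count_total :
  (c 0 + c 1 + c 2 + c r.+1 = #|F|.-1 * #|F|.-1)%N.
Proof.
have := sum_by_root_count (fun=> 1%N); rewrite !mul1n => <-.
rewrite sum1_card -(cardsC1 (0 : F)) -cardsX.
by apply: eq_card => ab; rewrite !inE.
Qed.

Lemma root_count_mean :
  (c 1 + 2 * c 2 + r.+1 * c r.+1 = #|F|.-1 * #|F|.-2)%N.
Proof.
have := sum_by_root_count id; rewrite mul0n mul1n => <-.
exact: sum_card_trinomial_roots.
Qed.

Lemma root_count_pairs :
  (2 * c 2 + r.+1 * r * c r.+1 = #|F|.-1 * (#|F|.-1 - gcdn r.+1 #|F|.-1))%N.
Proof.
have /= := sum_by_root_count (fun n => n * n.-1)%N.
rewrite !muln0 !mul0n muln1 !add0n => <-.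
rewrite -card_torsion_ratios // -sum_card_root_pairs //.
by apply: eq_bigr => ab _; rewrite card_root_pairs_predT.
Qed.

(** Counting only pairs whose ratio is an [(r-1)]-th power isolates the trinomials with [r + 1]
    roots, which the count of all pairs mixes with those having 2. *)
Lemma root_count_split (m := (#|F|.-1 %/ r.-1)%N) :
  (r.+1 * r * c r.+1 = #|F|.-1 * (m - gcdn m r.+1))%N.
Proof.
have := sum_by_root_count (fun n => if n == r.+1 then r.+1 * r else 0)%N.
rewrite eqxx !eqSS !ltn_eqF ?(ltnW r_gt1) // !mul0n !add0n => <-.
rewrite -card_power_ratios // -sum_card_root_pairs //.
apply: eq_bigr => ab; rewrite inE => /andP[_ b0].
by rewrite card_root_pairs_power.
Qed.

(** The four relations are triangular and are solved from [r + 1] roots down to none. The gcds stay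
    as parameters, since they alone depend on the parities of [r] and [d]. *)
Lemma root_counts (g h : nat) (R : rat := r%:R) (Q : rat := #|F|%:R) :
  gcdn r.+1 #|F|.-1 = g -> gcdn (#|F|.-1 %/ r.-1) r.+1 = h ->
  let c3 := (Q - 1) * ((Q - 1) / (R - 1) - h%:R) / (R * (R + 1)) in
  let c2 := ((Q - 1) * (Q - 1 - g%:R) - R * (R + 1) * c3) / 2 in
  let c1 := (Q - 1) * (Q - 2) - 2 * c2 - (R + 1) * c3 in
  [/\ (c 0)%:R = (Q - 1) ^+ 2 - c1 - c2 - c3, (c 1)%:R = c1,
      (c 2)%:R = c2 & (c r.+1)%:R = c3].
Proof.
move=> gE hE c3 c2 c1.
have q_gt1 : (1 < #|F|)%N := finNzRing_gt1 F.
have q1 : (0 < #|F|.-1)%N by rewrite -subn1 subn_gt0.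
have r1 : (0 < r.-1)%N by case: r r_gt1 => [|[]].
have m_gt0 : (0 < #|F|.-1 %/ r.-1)%N by rewrite divn_gt0 // (dvdn_leq q1 r_dvd).
(* These bounds make the truncated subtractions exact in the rationals. *)
have g_le : (g <= #|F|.-1)%N by rewrite -gE dvdn_leq ?dvdn_gcdr.
have h_le : (h <= #|F|.-1 %/ r.-1)%N by rewrite -hE dvdn_leq ?dvdn_gcdl.
have q1E : #|F|.-1%:R = Q - 1 :> rat by rewrite -subn1 natrB // ltnW.
have q2E : #|F|.-2%:R = Q - 2 :> rat by rewrite -subn2 natrB.
have r1E : r.-1%:R = R - 1 :> rat by rewrite -subn1 natrB // ltnW.
have R0 : R != 0 by rewrite pnatr_eq0 gtn_eqF // ltnW.
have R1 : R - 1 != 0 by rewrite -r1E pnatr_eq0 gtn_eqF.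
have R2 : R + 1 != 0 by rewrite natr1 pnatr_eq0.
have mE : (#|F|.-1 %/ r.-1)%:R = (Q - 1) / (R - 1) :> rat.
  by apply: (mulIf R1); rewrite divfK // -r1E -natrM divnK.
have rS : r.+1%:R = R + 1 by rewrite natr1.
have := congr1 (fun n => n%:R : rat) root_count_split.
have := congr1 (fun n => n%:R : rat) root_count_pairs.
have := congr1 (fun n => n%:R : rat) root_count_mean.
have := congr1 (fun n => n%:R : rat) root_count_total.
rewrite /= gE hE !natrD !natrM !natrB // q1E q2E mE rS -/R.
set C0 := (c 0)%:R; set C1 := (c 1)%:R; set C2 := (c 2)%:R; set C3 := (c r.+1)%:R.
move=> E0 E1 E2 E3.
have C3_eq : C3 = c3.
  by rewrite /c3 -E3; field; apply/andP.
have C2_eq : C2 = c2.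
  by rewrite /c2 -C3_eq -E2; field.
have C1_eq : C1 = c1 by rewrite /c1 -C2_eq -C3_eq -E1; ring.
by split=> //; rewrite -C1_eq -C2_eq -C3_eq expr2 -E0; ring.
Qed.

End RootCounts.

(** * The two gcds according to parity *)

Lemma card_pred_even (r k : nat) :
  exists t, ((r ^ k.*2).-1 = t * r.+1 * r.-1)%N.
Proof.
have /dvdnP[t tE] := card_pred_dvd (r ^ 2) k.
exists t; rewrite -mul2n expnM tE -mulnA; congr (_ * _)%N.
by case: r {tE} => [|s] //; rewrite -mulnn; nia.
Qed.

(** Write [r^(2k+1) - 1 = r (r^(2k) - 1) + (r - 1)] and use the even case: the quotient by [r - 1]
    is 1 modulo [r + 1]. *)
Lemma card_pred_odd (r k : nat) : (1 < r)%N ->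
  exists t, ((r ^ k.*2.+1).-1 = (t * r.+1).+1 * r.-1)%N.
Proof.
move=> r_gt1; have [t tE] := card_pred_even r k; exists (r * t)%N.
have rk : (0 < r ^ k.*2)%N by rewrite expn_gt0 ltnW.
by rewrite expnS -(prednK rk) tE; case: r r_gt1 {tE rk} => [|s] //= _; nia.
Qed.

Section Gcds.

Variables (r d : nat).
Hypothesis r_gt1 : (1 < r)%N.

Let r1_gt0 : (0 < r.-1)%N. Proof. by case: r r_gt1 => [|[]]. Qed.

Lemma gcd_even : ~~ odd d ->
  gcdn r.+1 (r ^ d).-1 = r.+1 /\ gcdn ((r ^ d).-1 %/ r.-1) r.+1 = r.+1.
Proof.
move=> d_even; have [t] := card_pred_even r d./2.
rewrite (even_halfK d_even) => ->; rewrite mulnK //; split.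
  by apply/gcdn_idPl; rewrite mulnAC dvdn_mull.
by rewrite gcdnC gcdnMl.
Qed.

Lemma gcd_odd : odd d ->
  gcdn r.+1 (r ^ d).-1 = (if odd r then 2 else 1)%N
  /\ gcdn ((r ^ d).-1 %/ r.-1) r.+1 = 1%N.
Proof.
move=> d_odd; have [t] := card_pred_odd d./2 r_gt1.
rewrite (odd_halfK d_odd) prednK ?odd_gt0 // => ->; rewrite mulnK //; split.
  rewrite mulSnr mulnAC gcdnMDl.
  rewrite -{1}(prednK (ltnW r_gt1)) -[r.-1.+2]addn2 gcdnC gcdnDl.
  have -> : odd r = ~~ odd r.-1 by rewrite -{1}(prednK (ltnW r_gt1)).
  case: ifPn => [r1_even | ]; first by apply/gcdn_idPr; rewrite dvdn2.
  by rewrite negbK -coprimen2 => /eqP.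
by rewrite -addn1 gcdnC gcdnMDl gcdn1.
Qed.

End Gcds.

Theorem corollary5p6 (p e r d q : nat) (F : finFieldType)
    (p_prime : prime p) (e_gt0 : (0 < e)%N) (r_def : r = (p ^ e)%N)
    (d_gt0 : (0 < d)%N) (q_def : q = (r ^ d)%N) (cardF : #|F| = q) :
  let R : rat := r%:R in
  let Q : rat := q%:R in
  [/\ forall i : nat, i \notin [:: 0; 1; 2; r.+1]%N -> C2 F r i = set0,
      ~~ odd d ->
        [/\ c2 F r 0 = R * (Q - 1) ^+ 2 / (2 * (R + 1)),
            c2 F r 1 = Q * (Q - 1) / R,
            c2 F r 2 = (Q - 1) ^+ 2 * (R - 2) / (2 * (R - 1))
          & c2 F r r.+1 = (Q - 1) * (Q - R ^+ 2) / (R * (R ^+ 2 - 1))],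
      odd r -> odd d ->
        [/\ c2 F r 0 = (Q * R - 1) * (Q - 1) / (2 * (R + 1)),
            c2 F r 1 = Q * (Q - 1) / R,
            c2 F r 2 = (Q - 1) * (Q * R - 2 * Q - 2 * R + 3) / (2 * (R - 1))
          & c2 F r r.+1 = (Q - R) * (Q - 1) / (R * (R ^+ 2 - 1))]
    & ~~ odd r -> odd d ->
        [/\ c2 F r 0 = R * (Q ^+ 2 - 1) / (2 * (R + 1)),
            c2 F r 1 = (Q - 1) * (Q - R) / R,
            c2 F r 2 = (Q - 1) ^+ 2 * (R - 2) / (2 * (R - 1))
          & c2 F r r.+1 = (Q - R) * (Q - 1) / (R * (R ^+ 2 - 1))]].
Proof.
move=> R Q.
have r_gt1 : (1 < r)%N.
  by rewrite r_def -(expn0 p) ltn_exp2l ?prime_gt1.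
have p_char : p \in [pchar F].
  by apply: (@card_finPcharP _ _ (e * d)) => //; rewrite cardF q_def r_def expnM.
have exprDr (x y : F) : (x + y) ^+ r = x ^+ r + y ^+ r.
  exact: exprDr_pchar r_def _ _ _ p_char.
have r_dvd : (r.-1 %| #|F|.-1)%N by rewrite cardF q_def card_pred_dvd.
have C2_roots i : C2 F r i = trinomials_with_roots F r i.
  exact: C2E p_char r_def r_gt1 i.
have c2_roots i : c2 F r i = #|trinomials_with_roots F r i|%:R.
  by rewrite /c2 C2_roots.
(* The cases differ only in the pair of gcds: [(r + 1, r + 1)] for even [d], [(2, 1)] for odd [r]
   and [d], [(1, 1)] for even [r] and odd [d]. The closed forms are then field identities in [R] and
   [Q]. *)
have counts := root_counts r_gt1 exprDr r_dvd.
have R0 : R != 0 by rewrite pnatr_eq0 gtn_eqF // ltnW.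
have R1 : R - 1 != 0 by rewrite subr_eq0 pnatr_eq1 gtn_eqF.
have R2 : R + 1 != 0 by rewrite natr1 pnatr_eq0.
have RR : R ^+ 2 - 1 != 0.
  by rewrite -(expr1n _ 2) subr_sqr mulf_neq0.
split.
- move=> i i_out; rewrite C2_roots; apply/setP => ab; rewrite !inE.
  apply/negP => /andP[/andP[_ b0] /eqP ni]; case/negP: i_out.
  by rewrite -ni card_trinomial_roots_in.
- move=> d_even; have [gE hE] := gcd_even r_gt1 d_even.
  rewrite -q_def -cardF in gE hE.
  rewrite !c2_roots; have [-> -> -> ->] := counts _ _ gE hE.
  rewrite -[r.+1%:R]natr1 cardF -/R -/Q.
  split; field; rewrite ?R0 ?R1 ?R2 ?RR //.
- move=> r_odd d_odd; have [gE hE] := gcd_odd r_gt1 d_odd.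
  rewrite -q_def -cardF r_odd in gE hE.
  rewrite !c2_roots; have [-> -> -> ->] := counts _ _ gE hE.
  rewrite cardF -/R -/Q.
  split; field; rewrite ?R0 ?R1 ?R2 ?RR //.
move=> r_even d_odd; have [gE hE] := gcd_odd r_gt1 d_odd.
rewrite -q_def -cardF (negPf r_even) in gE hE.
rewrite !c2_roots; have [-> -> -> ->] := counts _ _ gE hE.
rewrite cardF -/R -/Q.
split; field; rewrite ?R0 ?R1 ?R2 ?RR //.
Qed.
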